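(* Let $\mathsf{L}^{\mathsf{BA}}$ be the axiom system described in the context below, over the language $\mathcal{L}=(\mathsf{F},\mathsf{A})$. Then $\mathsf{L}^{\mathsf{BA}}$ is sound and complete with respect to the class $\mathcal{M}$ of all models: for every formula $\varphi\in\mathsf{F}$, $\varphi$ is derivable in $\mathsf{L}^{\mathsf{BA}}$ if and only if $\varphi$ is valid, i.e. $M,w\models\varphi$ for every model $M$ and every world $w$ of $M$.
   Context: Fix a countable set $\mathsf{At}$ of propositional letters. The language $\mathcal{L}=(\mathsf{F},\mathsf{A})$ consists of formulas $\mathsf{F}$ and arguments $\mathsf{A}$, generated simultaneously by $\varphi::= p \mid \lnot\varphi \mid (\varphi\land\varphi) \mid \square\varphi \mid \mathsf{aware}(\alpha) \mid \mathsf{conc}(\alpha)=\varphi \mid \mathsf{strict}(\alpha) \mid \mathsf{undercuts}(\alpha,\alpha) \mid \mathsf{wellshap}(\alpha)$ ($p\in\mathsf{At}$, $\alpha\in\mathsf{A}$), and $\alpha::= \langle\varphi\rangle \mid \langle\alpha_1,\dots,\alpha_n \twoheadrightarrow \varphi\rangle \mid \langle\alpha_1,\dots,\alpha_n\Rightarrow\varphi\rangle$ ($\varphi\in\mathsf{F}$, $n\ge1$). Other Boolean connectives, $\top,\perp$ and $\lozenge=\lnot\square\lnot$ are defined as usual. $\vdash_0$ denotes classical propositional consequence (treating formulas not built from $\lnot,\land$ over subformulas as propositional atoms). Syntactic functions on arguments (with $\hookrightarrow\in\{\twoheadrightarrow,\Rightarrow\}$): the conclusion $\mathsf{Conc}(\langle\varphi\rangle)=\mathsf{Conc}(\langle\alpha_1,\dots,\alpha_n\hookrightarrow\varphi\rangle)=\varphi$;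 premisses $\mathsf{Prem}(\langle\varphi\rangle)=\{\varphi\}$, $\mathsf{Prem}(\langle\alpha_1,\dots,\alpha_n\hookrightarrow\varphi\rangle)=\bigcup_i\mathsf{Prem}(\alpha_i)$; subarguments $\mathsf{sub_A}(\langle\varphi\rangle)=\{\langle\varphi\rangle\}$, $\mathsf{sub_A}(\beta)=\{\beta\}\cup\bigcup_i\mathsf{sub_A}(\alpha_i)$ for $\beta=\langle\alpha_1,\dots,\alpha_n\hookrightarrow\varphi\rangle$; $\mathsf{TopRule}(\langle\alpha_1,\dots,\alpha_n\hookrightarrow\varphi\rangle)=((\mathsf{Conc}(\alpha_1),\dots,\mathsf{Conc}(\alpha_n)),\varphi)$ (undefined for atomic arguments); $\mathsf{DefRule}(\langle\varphi\rangle)=\emptyset$, $\mathsf{DefRule}(\langle\alpha_1,\dots,\alpha_n\twoheadrightarrow\varphi\rangle)=\bigcup_i\mathsf{DefRule}(\alpha_i)$, $\mathsf{DefRule}(\langle\alpha_1,\dots,\alpha_n\Rightarrow\varphi\rangle)=\{((\mathsf{Conc}(\alpha_1),\dots,\mathsf{Conc}(\alpha_n)),\varphi)\}\cup\bigcup_i\mathsf{DefRule}(\alpha_i)$. $\mathsf{SEQ}(\mathsf{F})$ is the set of finite sequences over $\mathsf{F}$, written $((\varphi_1,\dots,\varphi_n),\varphi)$; for such $R$, $\alpha^R:=\langle\langle\varphi_1\rangle,\dots,\langle\varphi_n\rangle\Rightarrow\varphi\rangle$. A model is $M=(W,\mathcal{B},\mathcal{O},\mathcal{D},\mathfrak{n},\|\cdot\|)$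 with $W\neq\emptyset$; $\emptyset\neq\mathcal{B}\subseteq W$; $\mathcal{O}\subseteq\mathsf{A}$; $\mathcal{D}\subseteq\mathsf{SEQ}(\mathsf{F})$ such that every $((\varphi_1,\dots,\varphi_n),\varphi)\in\mathcal{D}$ satisfies $\{\varphi_1,\dots,\varphi_n,\varphi\}\nvdash_0\perp$ and $\{\varphi_1,\dots,\varphi_n\}\nvdash_0\varphi$; $\mathfrak{n}:\mathsf{SEQ}(\mathsf{F})\to\mathsf{At}$ a possibly partial function; $\|\cdot\|:\mathsf{At}\to\wp(W)$. The set $WS^M\subseteq\mathsf{A}$ of well-shaped arguments is the smallest set such that: $\langle\varphi\rangle\in WS^M$ for all $\varphi$; $\langle\alpha_1,\dots,\alpha_n\twoheadrightarrow\varphi\rangle\in WS^M$ iff all $\alpha_i\in WS^M$ and $\{\mathsf{Conc}(\alpha_1),\dots,\mathsf{Conc}(\alpha_n)\}\vdash_0\varphi$; $\langle\alpha_1,\dots,\alpha_n\Rightarrow\varphi\rangle\in WS^M$ iff all $\alpha_i\in WS^M$ and $((\mathsf{Conc}(\alpha_1),\dots,\mathsf{Conc}(\alpha_n)),\varphi)\in\mathcal{D}$. Truth at $w\in W$: $M,w\models p$ iff $w\in\|p\|$; Boolean clauses as usual; $M,w\models\square\varphi$ iff $M,w'\models\varphi$ for all $w'\in\mathcal{B}$; $M,w\models\mathsf{aware}(\alpha)$ iff $\alpha\in\mathcal{O}$; $M,w\models\mathsf{conc}(\alpha)=\varphi$ iff $\mathsf{Conc}(\alpha)=\varphi$; $M,w\models\mathsf{strict}(\alpha)$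 iff $\mathsf{DefRule}(\alpha)=\emptyset$; $M,w\models\mathsf{undercuts}(\alpha,\beta)$ iff $\beta$ has the form $\langle\beta_1,\dots,\beta_n\Rightarrow\psi\rangle$ and $\mathsf{Conc}(\alpha)=\lnot\mathfrak{n}(\mathsf{TopRule}(\beta))$ (with $\mathfrak{n}$ defined there); $M,w\models\mathsf{wellshap}(\alpha)$ iff $\alpha\in WS^M$. The axiom system $\mathsf{L}^{\mathsf{BA}}$ (all $\alpha,\beta,\alpha_i,\beta_i\in\mathsf{A}$, $\varphi\in\mathsf{F}$, $p,q\in\mathsf{At}$, $R\in\mathsf{SEQ}(\mathsf{F})$) has: (Ax0) all propositional tautologies; (Ax1) the KD45 axioms for $\square$; (Ax2)–(Ax7): $\chi\to\square\chi$ and $\lnot\chi\to\square\lnot\chi$ for $\chi$ each of $\mathsf{aware}(\alpha)$, $\mathsf{wellshap}(\alpha)$, $\mathsf{undercuts}(\alpha,\beta)$; (Ax8) $\mathsf{conc}(\alpha)=\varphi$ whenever $\mathsf{Conc}(\alpha)=\varphi$; (Ax9) $\lnot\,\mathsf{conc}(\alpha)=\varphi$ whenever $\mathsf{Conc}(\alpha)\neq\varphi$; (Ax10) $\mathsf{strict}(\alpha)$ whenever $\mathsf{DefRule}(\alpha)=\emptyset$; (Ax11) $\lnot\mathsf{strict}(\alpha)$ whenever $\mathsf{DefRule}(\alpha)\ne\emptyset$; (Ax12) $\mathsf{wellshap}(\langle\varphi\rangle)$; (Ax13) $\mathsf{wellshap}(\langle\alpha_1,\dots,\alpha_n\twoheadrightarrow\varphi\rangle)\to\bigwedge_i\mathsf{wellshap}(\alpha_i)$;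 (Ax14) $\bigwedge_i\mathsf{wellshap}(\alpha_i)\to\mathsf{wellshap}(\langle\alpha_1,\dots,\alpha_n\twoheadrightarrow\varphi\rangle)$ whenever $\{\mathsf{Conc}(\alpha_i)\}_i\vdash_0\varphi$; (Ax15) $\lnot\mathsf{wellshap}(\langle\alpha_1,\dots,\alpha_n\twoheadrightarrow\varphi\rangle)$ whenever $\{\mathsf{Conc}(\alpha_i)\}_i\nvdash_0\varphi$; (Ax16) $\big(\bigwedge_i\mathsf{wellshap}(\alpha_i)\land\mathsf{wellshap}(\langle\langle\mathsf{Conc}(\alpha_1)\rangle,\dots,\langle\mathsf{Conc}(\alpha_n)\rangle\Rightarrow\varphi\rangle)\big)\leftrightarrow\mathsf{wellshap}(\langle\alpha_1,\dots,\alpha_n\Rightarrow\varphi\rangle)$; (Ax17) $\mathsf{wellshap}(\langle\alpha_1,\dots,\alpha_n\Rightarrow\varphi\rangle)\to\lnot\mathsf{wellshap}(\langle\langle\mathsf{Conc}(\alpha_1)\rangle,\dots,\langle\mathsf{Conc}(\alpha_n)\rangle,\langle\varphi\rangle\twoheadrightarrow\perp\rangle)$; (Ax18) $\mathsf{wellshap}(\langle\alpha_1,\dots,\alpha_n\Rightarrow\varphi\rangle)\to\lnot\mathsf{wellshap}(\langle\alpha_1,\dots,\alpha_n\twoheadrightarrow\varphi\rangle)$; (Ax19) $\mathsf{undercuts}(\langle\lnot p\rangle,\alpha^R)\to\lnot\mathsf{undercuts}(\langle\lnot q\rangle,\alpha^R)$ whenever $q\neq p$; (Ax20) $\lnot\mathsf{undercuts}(\alpha,\langle\varphi\rangle)$;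 (Ax21) $\lnot\mathsf{undercuts}(\alpha,\langle\alpha_1,\dots,\alpha_n\twoheadrightarrow\varphi\rangle)$; (Ax22) $\lnot\mathsf{undercuts}(\alpha,\beta)$ whenever $\mathsf{Conc}(\alpha)$ is not of the form $\lnot p$ for any $p\in\mathsf{At}$; (Ax23) $\big(\mathsf{undercuts}(\langle\lnot p\rangle,\langle\langle\mathsf{Conc}(\beta_1)\rangle,\dots,\langle\mathsf{Conc}(\beta_n)\rangle\Rightarrow\varphi\rangle)\land\mathsf{conc}(\alpha)=\lnot p\big)\to\mathsf{undercuts}(\alpha,\langle\beta_1,\dots,\beta_n\Rightarrow\varphi\rangle)$; (Ax24) $\big(\mathsf{undercuts}(\alpha,\langle\beta_1,\dots,\beta_n\Rightarrow\varphi\rangle)\land\mathsf{conc}(\alpha)=\lnot p\big)\to\mathsf{undercuts}(\langle\lnot p\rangle,\langle\langle\mathsf{Conc}(\beta_1)\rangle,\dots,\langle\mathsf{Conc}(\beta_n)\rangle\Rightarrow\varphi\rangle)$; rules (MP) from $\varphi\to\psi$ and $\varphi$ infer $\psi$, and (Nec) from $\varphi$ infer $\square\varphi$. *)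

(* Defs.v *)
From Stdlib Require List.
From mathcomp Require Import all_boot.

Set Implicit Arguments.
Unset Strict Implicit.
Unset Printing Implicit Defensive.

(* A nonempty list alpha_1, ..., alpha_n is given by its head and its tail,
   which builds n >= 1 into the grammar. *)
Inductive fm (At : Type) : Type :=
| Atom of At
| Neg of fm At
| And of fm At & fm At
| Box of fm At
| Aware of arg At
| ConcIs of arg At & fm At
| Strict of arg At
| Undercuts of arg At & arg At
| WellShap of arg At
with arg (At : Type) : Type :=
| AtomArg of fm At
| StrictArg of arg At & seq (arg At) & fm At
| DefArg of arg At & seq (arg At) & fm At.

Arguments AtomArg {At} _.

Definition Imp {At : Type} (f g : fm At) : fm At := Neg (And f (Neg g)).
Definition Iff {At : Type} (f g : fm At) : fm At := And (Imp f g) (Imp g f).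
Definition Dia {At : Type} (f : fm At) : fm At := Neg (Box (Neg f)).

Declare Scope fm_scope.
Delimit Scope fm_scope with F.
Bind Scope fm_scope with fm.
Notation "f ~~> g" := (Imp f g) (at level 60, right associativity) : fm_scope.
Notation "f <~> g" := (Iff f g) (at level 65, no associativity) : fm_scope.

(* Falsum is not primitive: it abbreviates a contradiction in a fixed
   letter p0. *)
Definition Bot {At : Type} (p0 : At) : fm At := And (Atom p0) (Neg (Atom p0)).

Fixpoint BigAnd {At : Type} (f : fm At) (s : seq (fm At)) : fm At :=
  if s is g :: s' then And f (BigAnd g s') else f.

(* Formulas whose main operator is neither Neg nor And are the propositional
   atoms here; only the values of v on those formulas matter. *)
Fixpoint peval {At : Type} (v : fm At -> bool) (f : fm At) : bool :=
  match f with
  | Neg g => ~~ peval v g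
  | And g h => peval v g && peval v h
  | _ => v f
  end.

(* Only finite premiss sets occur; they are represented as lists. *)
Definition pcons {At : Type} (G : seq (fm At)) (f : fm At) : Prop :=
  forall v : fm At -> bool, all (peval v) G -> peval v f.

(* (f1, fs, f) stands for the sequence ((f1, fs_1, ..., fs_k), f). *)
Definition rule (At : Type) : Type := (fm At * seq (fm At) * fm At)%type.

Definition rprem {At : Type} (R : rule At) : seq (fm At) := R.1.1 :: R.1.2.
Definition rconc {At : Type} (R : rule At) : fm At := R.2.

Definition arg_of_rule {At : Type} (R : rule At) : arg At :=
  DefArg (AtomArg R.1.1) (map AtomArg R.1.2) R.2.

Definition Conc {At : Type} (a : arg At) : fm At :=
  match a with
  | AtomArg f => f
  | StrictArg _ _ f => f
  | DefArg _ _ f => f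
  end.

Definition TopRule {At : Type} (a : arg At) : option (rule At) :=
  match a with
  | AtomArg _ => None
  | StrictArg b s f => Some (Conc b, map Conc s, f)
  | DefArg b s f => Some (Conc b, map Conc s, f)
  end.

(* The finite set of defeasible rules, as a list. *)
Fixpoint DefRule {At : Type} (a : arg At) : seq (rule At) :=
  match a with
  | AtomArg _ => [::]
  | StrictArg b s f => DefRule b ++ flatten (map DefRule s)
  | DefArg b s f =>
      (Conc b, map Conc s, f) :: DefRule b ++ flatten (map DefRule s)
  end.

Record model (At : Type) (p0 : At) : Type := Model {
  world : Type;
  belief : world -> Prop;
  owned : arg At -> Prop;
  drules : rule At -> Prop;
  rname : rule At -> option At;
  valuation : At -> world -> Prop;
  world_nonempty : exists w : world, True;
  belief_nonempty : exists w : world, belief w;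
  drules_consistent : forall R : rule At, drules R ->
    ~ pcons (rcons (rprem R) (rconc R)) (Bot p0);
  drules_nonstrict : forall R : rule At, drules R ->
    ~ pcons (rprem R) (rconc R)
}.

Inductive WS {At : Type} {p0 : At} (M : model p0) : arg At -> Prop :=
| WS_atom (f : fm At) : WS M (AtomArg f)
| WS_strict (a : arg At) (s : seq (arg At)) (f : fm At) :
    (forall b : arg At, List.In b (a :: s) -> WS M b) ->
    pcons (map Conc (a :: s)) f ->
    WS M (StrictArg a s f)
| WS_def (a : arg At) (s : seq (arg At)) (f : fm At) :
    (forall b : arg At, List.In b (a :: s) -> WS M b) ->
    drules M (Conc a, map Conc s, f) ->
    WS M (DefArg a s f).

Definition undercuts_in {At : Type} {p0 : At} (M : model p0)
    (a b : arg At) : Prop :=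
  (exists b1 s f, b = DefArg b1 s f) /\
  exists R p, [/\ TopRule b = Some R, rname M R = Some p
                & Conc a = Neg (Atom p)].

Fixpoint sat {At : Type} {p0 : At} (M : model p0) (w : world M)
    (f : fm At) : Prop :=
  match f with
  | Atom p => valuation p w
  | Neg g => ~ sat w g
  | And g h => sat w g /\ sat w h
  | Box g => forall w' : world M, belief w' -> sat w' g
  | Aware a => owned M a
  | ConcIs a g => Conc a = g
  | Strict a => DefRule a = [::]
  | Undercuts a b => undercuts_in M a b
  | WellShap a => WS M a
  end.

Definition valid {At : Type} (p0 : At) (f : fm At) : Prop :=
  forall (M : model p0) (w : world M), sat w f.

Definition wellshaps {At : Type} (a : arg At) (s : seq (arg At)) : fm At :=
  BigAnd (WellShap a) (map (@WellShap At) s).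

Definition conc_atoms {At : Type} (s : seq (arg At)) : seq (arg At) :=
  map (fun a => AtomArg (Conc a)) s.

Local Open Scope fm_scope.

Inductive LBA_axiom {At : Type} (p0 : At) : fm At -> Prop :=
| Ax0 f : pcons [::] f -> LBA_axiom p0 f
| Ax1_K f g : LBA_axiom p0 (Box (f ~~> g) ~~> Box f ~~> Box g)
| Ax1_D f : LBA_axiom p0 (Box f ~~> Dia f)
| Ax1_4 f : LBA_axiom p0 (Box f ~~> Box (Box f))
| Ax1_5 f : LBA_axiom p0 (Neg (Box f) ~~> Box (Neg (Box f)))
| Ax2 a : LBA_axiom p0 (Aware a ~~> Box (Aware a))
| Ax3 a : LBA_axiom p0 (Neg (Aware a) ~~> Box (Neg (Aware a)))
| Ax4 a : LBA_axiom p0 (WellShap a ~~> Box (WellShap a))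
| Ax5 a : LBA_axiom p0 (Neg (WellShap a) ~~> Box (Neg (WellShap a)))
| Ax6 a b : LBA_axiom p0 (Undercuts a b ~~> Box (Undercuts a b))
| Ax7 a b : LBA_axiom p0 (Neg (Undercuts a b) ~~> Box (Neg (Undercuts a b)))
| Ax8 a f : Conc a = f -> LBA_axiom p0 (ConcIs a f)
| Ax9 a f : Conc a <> f -> LBA_axiom p0 (Neg (ConcIs a f))
| Ax10 a : DefRule a = [::] -> LBA_axiom p0 (Strict a)
| Ax11 a : DefRule a <> [::] -> LBA_axiom p0 (Neg (Strict a))
| Ax12 f : LBA_axiom p0 (WellShap (AtomArg f))
| Ax13 a s f :
    LBA_axiom p0 (WellShap (StrictArg a s f) ~~> wellshaps a s)
| Ax14 a s f : pcons (map Conc (a :: s)) f ->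
    LBA_axiom p0 (wellshaps a s ~~> WellShap (StrictArg a s f))
| Ax15 a s f : ~ pcons (map Conc (a :: s)) f ->
    LBA_axiom p0 (Neg (WellShap (StrictArg a s f)))
| Ax16 a s f :
    LBA_axiom p0
      (And (wellshaps a s)
           (WellShap (DefArg (AtomArg (Conc a)) (conc_atoms s) f))
       <~> WellShap (DefArg a s f))
| Ax17 a s f :
    LBA_axiom p0
      (WellShap (DefArg a s f) ~~>
       Neg (WellShap (StrictArg (AtomArg (Conc a))
                        (rcons (conc_atoms s) (AtomArg f)) (Bot p0))))
| Ax18 a s f :
    LBA_axiom p0
      (WellShap (DefArg a s f) ~~> Neg (WellShap (StrictArg a s f)))
| Ax19 p q R : q <> p ->
    LBA_axiom p0
      (Undercuts (AtomArg (Neg (Atom p))) (arg_of_rule R) ~~>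
       Neg (Undercuts (AtomArg (Neg (Atom q))) (arg_of_rule R)))
| Ax20 a f : LBA_axiom p0 (Neg (Undercuts a (AtomArg f)))
| Ax21 a b s f : LBA_axiom p0 (Neg (Undercuts a (StrictArg b s f)))
| Ax22 a b : (forall p : At, Conc a <> Neg (Atom p)) ->
    LBA_axiom p0 (Neg (Undercuts a b))
| Ax23 a b s f p :
    LBA_axiom p0
      (And (Undercuts (AtomArg (Neg (Atom p)))
              (DefArg (AtomArg (Conc b)) (conc_atoms s) f))
           (ConcIs a (Neg (Atom p)))
       ~~> Undercuts a (DefArg b s f))
| Ax24 a b s f p :
    LBA_axiom p0
      (And (Undercuts a (DefArg b s f)) (ConcIs a (Neg (Atom p)))
       ~~> Undercuts (AtomArg (Neg (Atom p)))
             (DefArg (AtomArg (Conc b)) (conc_atoms s) f)).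

Inductive derivable {At : Type} (p0 : At) : fm At -> Prop :=
| D_ax f : LBA_axiom p0 f -> derivable p0 f
| D_MP f g : derivable p0 (f ~~> g) -> derivable p0 f -> derivable p0 g
| D_Nec f : derivable p0 f -> derivable p0 (Box f).

(* Main.v *)
(** Completeness is by a canonical model built around a single maximal
    consistent set [w0].  Its worlds are the maximal consistent sets with the
    same boxed formulas as [w0], its beliefs those that contain every [f] with
    [Box f] in [w0]; KD45 makes this a model of the boxed fragment.  Awareness,
    well-shapedness and undercutting obey [chi -> Box chi] and
    [~ chi -> Box (~ chi)], so with seriality all worlds agree on them and the
    world-independent components can be read off [w0].  By axioms 16, 23 and 24
    it suffices to read rules and their names off the arguments
    [arg_of_rule R]. *)
Require Import Defs.
From mathcomp Require Import all_boot boolp classical_sets.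
From Stdlib Require List.

Set Implicit Arguments.
Unset Strict Implicit.
Unset Printing Implicit Defensive.

Local Open Scope classical_set_scope.
Local Open Scope fm_scope.

(** * Induction on arguments, and lists of conclusions *)

Section Syntax.

Variable At : Type.
Implicit Types (a b : arg At) (s : seq (arg At)) (f g : fm At).

(* The automatically generated scheme has no hypothesis for the arguments
   inside the premiss list. *)
Fixpoint arg_nested_ind (P : arg At -> Prop)
    (Patom : forall f, P (AtomArg f))
    (Pstrict : forall a s f,
      (forall b, List.In b (a :: s) -> P b) -> P (StrictArg a s f))
    (Pdef : forall a s f,
      (forall b, List.In b (a :: s) -> P b) -> P (DefArg a s f))
    a {struct a} : P a.
Proof.
pose IH := arg_nested_ind P Patom Pstrict Pdef.
case: a => [f|a s f|a s f]; first exact: Patom.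
- apply: (Pstrict a s f); suff Ps : forall b, List.In b s -> P b.
    by move=> b [<-|/Ps]; first exact: IH.
  by elim: s => [b []|c s IHs b [<-|/IHs]] //; exact: IH.
- apply: (Pdef a s f); suff Ps : forall b, List.In b s -> P b.
    by move=> b [<-|/Ps]; first exact: IH.
  by elim: s => [b []|c s IHs b [<-|/IHs]] //; exact: IH.
Qed.

Lemma map_Conc_conc_atoms s : map (@Conc At) (conc_atoms s) = map (@Conc At) s.
Proof. by rewrite /conc_atoms -map_comp. Qed.

Lemma conc_atoms_map_AtomArg (fs : seq (fm At)) :
  conc_atoms (map AtomArg fs) = map AtomArg fs.
Proof. by rewrite /conc_atoms -map_comp. Qed.

Lemma map_Conc_AtomArg (fs : seq (fm At)) :
  map (@Conc At) (map AtomArg fs) = fs.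
Proof. by rewrite -map_comp map_id. Qed.

(** This identifies the arguments with atomic premisses in axioms 16, 23 and 24 with the rule
    arguments from which the canonical model is read off. *)
Lemma arg_of_rule_top a s f :
  arg_of_rule (Conc a, map (@Conc At) s, f)
  = DefArg (AtomArg (Conc a)) (conc_atoms s) f.
Proof. by rewrite /arg_of_rule /conc_atoms /= -map_comp. Qed.

End Syntax.

(** * Soundness *)

Section Soundness.

Variables (At : Type) (p0 : At) (M : model p0).
Implicit Types (a b : arg At) (s : seq (arg At)) (f g : fm At) (w : world M).

Lemma sat_Imp w f g : sat w (f ~~> g) <-> (sat w f -> sat w g).
Proof.
split=> /= [nfg wf|fg [wf]]; last by apply; exact: fg.
by apply: contrapT => nwg; exact: nfg.
Qed.

(** Classically, truth at a world is a propositional valuation; this makes tautologies true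
    there. *)
Lemma peval_sat w f : peval (fun g => `[< sat w g >]) f = `[< sat w f >].
Proof. by elim: f => //= [f ->|f -> g ->]; rewrite ?asbool_neg ?asbool_and. Qed.

Lemma sat_wellshaps w a s :
  sat w (wellshaps a s) <-> (forall b, List.In b (a :: s) -> WS M b).
Proof.
rewrite /wellshaps; elim: s a => [|c s IHs] a /=.
  by split=> [wa b [<-|]|] //; apply; left.
split=> [[wa /IHs ws] b [<-|]|ws] //; first exact: ws.
by split; [apply: ws; left|apply/IHs => b bs; apply: ws; right].
Qed.

Lemma WS_StrictArg a s f : WS M (StrictArg a s f) <->
  (forall b, List.In b (a :: s) -> WS M b) /\ pcons (map (@Conc At) (a :: s)) f.
Proof. by split=> [H|[? ?]]; [inversion H|exact: WS_strict]. Qed.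

Lemma WS_DefArg a s f : WS M (DefArg a s f) <->
  (forall b, List.In b (a :: s) -> WS M b) /\
  drules M (Conc a, map (@Conc At) s, f).
Proof. by split=> [H|[? ?]]; [inversion H|exact: WS_def]. Qed.

Lemma WS_conc_atoms s b : List.In b (conc_atoms s) -> WS M b.
Proof. by elim: s => //= c s IHs [<-|/IHs]; first exact: WS_atom. Qed.

Lemma undercuts_in_DefArg a b s f : undercuts_in M a (DefArg b s f) <->
  exists2 p, rname M (Conc b, map (@Conc At) s, f) = Some p
           & Conc a = Neg (Atom p).
Proof.
split=> [[_ [R [p [[<-] Rp ap]]]]|[p Rp ap]]; first by exists p.
by split; [exists b, s, f|exists (Conc b, map (@Conc At) s, f), p].
Qed.

Lemma axiom_sat w f : LBA_axiom p0 f -> sat w f.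
Proof.
case=> {f}.
- move=> f /(_ (fun g => `[< sat w g >]) isT).
  by rewrite peval_sat => /asboolP.
- move=> f g; rewrite !sat_Imp => fg bf v Bv.
  by have /sat_Imp := fg v Bv; apply; exact: bf.
- move=> f; rewrite sat_Imp /= => bf bnf.
  by have [v Bv] := belief_nonempty M; exact: bnf v Bv (bf v Bv).
(* From here through axiom 7, the formula put under the box is interpreted without reference to the
   world. *)
- by move=> f; apply/sat_Imp => bf v _.
- by move=> f; apply/sat_Imp => bf v _.
- by move=> a; apply/sat_Imp => sa v _.
- by move=> a; apply/sat_Imp => sa v _.
- by move=> a; apply/sat_Imp => sa v _.
- by move=> a; apply/sat_Imp => sa v _.
- by move=> a b; apply/sat_Imp => sab v _.
- by move=> a b; apply/sat_Imp => sab v _.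
- by [].
- by [].
- by [].
- by [].
- by move=> f; exact: WS_atom.
- by move=> a s f; rewrite sat_Imp sat_wellshaps => /WS_StrictArg[].
- by move=> a s f sf; rewrite sat_Imp sat_wellshaps => ws; exact: WS_strict.
- by move=> a s f nsf /WS_StrictArg[].
- move=> a s f; split; apply/sat_Imp.
    move=> [/sat_wellshaps ws /WS_DefArg[_]] /=.
    by rewrite map_Conc_conc_atoms => D; exact: WS_def.
  move=> /WS_DefArg[ws D]; split; first exact/sat_wellshaps.
  apply: WS_def; last by rewrite map_Conc_conc_atoms.
  by move=> b [<-|/WS_conc_atoms //]; exact: WS_atom.
- move=> a s f; apply/sat_Imp => /WS_DefArg[_ D] /WS_StrictArg[_] /=.
  rewrite map_rcons map_Conc_conc_atoms /=; exact: drules_consistent D.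
- move=> a s f; apply/sat_Imp => /WS_DefArg[_ D] /WS_StrictArg[_].
  exact: drules_nonstrict D.
- move=> p q R qp; apply/sat_Imp => /undercuts_in_DefArg[p' Rp' [pp']].
  move=> /undercuts_in_DefArg[q' Rq' [qq']]; apply: qp; rewrite pp' qq'.
  by move: Rq'; rewrite Rp' => -[].
- by move=> a f [[? [? [? ]]]].
- by move=> a b s f [[? [? [? ]]]].
- by move=> a b nap [_ [R [p [_ _ /nap]]]].
- move=> a b s f p; apply/sat_Imp => -[/undercuts_in_DefArg[q] /=].
  rewrite map_Conc_conc_atoms => Rq [->] ap.
  by apply/undercuts_in_DefArg; exists q.
- move=> a b s f p; apply/sat_Imp => -[/undercuts_in_DefArg[q Rq aq]] /= ap.
  apply/undercuts_in_DefArg; exists q; first by rewrite map_Conc_conc_atoms.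
  by rewrite /= -ap.
Qed.

End Soundness.

Lemma soundness (At : Type) (p0 : At) (f : fm At) :
  derivable p0 f -> valid p0 f.
Proof.
(* The world stays quantified, since necessitation moves to other worlds. *)
move=> d M; elim: d => {f}.
- by move=> f ax w; exact: axiom_sat.
- by move=> f g _ fg _ vf w; have /sat_Imp := fg w; apply.
- by move=> f _ vf w v _; exact: vf.
Qed.

(** * Local derivability and the Lindenbaum lemma *)

Section Completeness.

Variables (At : Type) (p0 : At).
Implicit Types (G X u : set (fm At)) (f g h : fm At).
Implicit Types (a b : arg At) (s : seq (arg At)).

(* Necessitation is not available from hypotheses, so that the deduction
   theorem holds. *)
Inductive entails G : fm At -> Prop :=
| entails_thm f : derivable p0 f -> entails G f
| entails_hyp f : G f -> entails G f
| entails_MP f g : entails G (f ~~> g) -> entails G f -> entails G g.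

Lemma pcons_cons g (fs : seq (fm At)) f :
  pcons (g :: fs) f -> pcons fs (g ~~> f).
Proof.
move=> gf v /= vfs; apply/negP => /andP[vg /negP]; apply.
by apply: gf; rewrite /= vg.
Qed.

Lemma entails_pcons G (fs : seq (fm At)) f : pcons fs f ->
  (forall g, List.In g fs -> entails G g) -> entails G f.
Proof.
elim: fs f => [|g fs IHfs] f fsf Gfs.
  by apply: entails_thm; apply: D_ax; exact: Ax0.
apply: entails_MP (Gfs g _); last by left.
by apply: IHfs => [|h fsh]; [exact: pcons_cons|apply: Gfs; right].
Qed.

Lemma entails_pcons1 G f g : pcons [:: f] g -> entails G f -> entails G g.
Proof. by move=> fg Gf; apply: entails_pcons fg _ => h [<-|]. Qed.

Lemma entails_pcons2 G f g h :
  pcons [:: f; g] h -> entails G f -> entails G g -> entails G h.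
Proof. by move=> fgh Gf Gg; apply: entails_pcons fgh _ => k [<-|[<-|]]. Qed.

Lemma entails_deduction G f g : entails (f |` G) g -> entails G (f ~~> g).
Proof.
elim=> {g} [g dg|g [->|Gg]|g h _ fgh _ fg].
- apply: (@entails_pcons1 _ g); last exact: entails_thm.
  by move=> v /=; case: (peval v f); case: (peval v g).
- by apply: (@entails_pcons _ [::]) => // v _ /=; case: (peval v f).
- apply: (@entails_pcons1 _ g); last exact: entails_hyp.
  by move=> v /=; case: (peval v f); case: (peval v g).
- apply: entails_pcons2 fgh fg => v /=.
  by case: (peval v f); case: (peval v g); case: (peval v h).
Qed.

Lemma entails_subset G X f : G `<=` X -> entails G f -> entails X f.
Proof.
move=> GX; elim=> {f} [f df|f /GX Xf|f g _ + _].
- exact: entails_thm.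
- exact: entails_hyp.
- exact: entails_MP.
Qed.

(** A derivation uses finitely many hypotheses, so the larger of two members of the chain serves at
    each modus ponens. The first alternative covers the empty chain. *)
Lemma entails_chain G (F : set (set (fm At))) f : total_on F subset ->
  entails (G `|` \bigcup_(X in F) X) f ->
  entails G f \/ exists2 X, F X & entails (G `|` X) f.
Proof.
move=> Ftot; elim=> {f} [f df|f [Gf|[X FX Xf]]|f g _ IHfg _ IHf].
- by left; exact: entails_thm.
- by left; exact: entails_hyp.
- by right; exists X => //; apply: entails_hyp; right.
- case: IHfg => [Gfg|[X FX Xfg]]; case: IHf => [Gf|[Y FY Yf]].
  + by left; exact: entails_MP Gfg Gf.
  + right; exists Y => //; apply: entails_MP Yf.
    by apply: entails_subset Gfg; exact: subsetUl.
  + right; exists X => //; apply: entails_MP Xfg _.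
    by apply: entails_subset Gf; exact: subsetUl.
  + right; have [XY|YX] := Ftot X Y FX FY.
      exists Y => //; apply: entails_MP Yf.
      by apply: entails_subset Xfg; exact: setUS.
    exists X => //; apply: entails_MP Xfg _.
    by apply: entails_subset Yf; exact: setUS.
Qed.

(** Consistency and maximality under inclusion both follow from these two closure conditions, which
    are the form used in the truth lemma. *)
Record mcs u : Prop := Mcs {
  mcs_entails : forall f, entails u f -> u f;
  mcs_Neg : forall f, u (Neg f) <-> ~ u f }.

Lemma lindenbaum G f : ~ entails G f ->
  exists u, [/\ mcs u, G `<=` u & ~ u f].
Proof.
(* Zorn's lemma runs over the sets [X] to be joined to [G], not over supersets of [G], so that the
   empty union qualifies too. *)
move=> nGf; have [|X [nXf Xmax]] :=
    @Zorn_bigcup (fm At) [set X | ~ entails (G `|` X) f].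
  by move=> F sF Ftot /(entails_chain Ftot)[/nGf|[X /sF]].
have Xin g : ~ entails (G `|` (g |` X)) f -> X g.
  move=> ngf; apply: contrapT => nXg; apply: (Xmax (g |` X)) ngf.
  by split=> [|/(_ g)XX]; [exact: subsetUr|apply/nXg/XX; left].
have Xcl g : entails (G `|` X) g -> X g.
  move=> GXg; apply: Xin; rewrite setUCA => /entails_deduction GXgf.
  exact: nXf (entails_MP GXgf GXg).
have GX : G `<=` X by move=> g Gg; apply: Xcl; apply: entails_hyp; left.
exists X; split=> //; last by move=> Xf; apply: nXf; apply: entails_hyp; right.
split=> [g Xg|g]; first by apply: Xcl; apply: entails_subset Xg; exact: subsetUr.
split=> [Xng Xg|nXg].
  apply: nXf; apply: (@entails_pcons2 _ g (Neg g)).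
  - by move=> v /=; case: (peval v g).
  - by apply: entails_hyp; right.
  - by apply: entails_hyp; right.
(* If neither [g] nor [Neg g] could be added, both would lead to [f], which would then follow by
   cases. *)
apply: (Xin (Neg g)); rewrite setUCA => /entails_deduction ngf.
apply: nXg; apply: (Xin g).
rewrite setUCA => /entails_deduction gf.
apply: nXf; apply: entails_pcons2 gf ngf => v /=.
by case: (peval v g); case: (peval v f).
Qed.

(** * Closure properties of maximal consistent sets *)

Section MaximalConsistent.

Variables (u : set (fm At)) (mu : mcs u).

Lemma mcs_thm f : derivable p0 f -> u f.
Proof. by move=> df; apply: mcs_entails => //; exact: entails_thm. Qed.

Lemma mcs_axiom f : LBA_axiom p0 f -> u f.
Proof. by move=> ax; apply: mcs_thm; exact: D_ax. Qed.

Lemma mcs_pcons1 f g : pcons [:: f] g -> u f -> u g.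
Proof.
move=> fg uf; apply: mcs_entails => //; apply: entails_pcons1 fg _.
exact: entails_hyp.
Qed.

Lemma mcs_And f g : u (And f g) <-> u f /\ u g.
Proof.
split=> [ufg|[uf ug]].
  by split; apply: mcs_pcons1 ufg => v /= /andP[/andP[]].
apply: mcs_entails => //; apply: (@entails_pcons2 _ f g).
- by move=> v /= /and3P[-> ->].
- exact: entails_hyp.
- exact: entails_hyp.
Qed.

Lemma mcs_Imp f g : u (f ~~> g) <-> (u f -> u g).
Proof.
rewrite mcs_Neg // mcs_And mcs_Neg //.
split=> [nfg uf|fg [uf]]; last by apply; exact: fg.
by apply: contrapT => nug; exact: nfg.
Qed.

Lemma mcs_MP f g : LBA_axiom p0 (f ~~> g) -> u f -> u g.
Proof. by move=> /mcs_axiom/mcs_Imp. Qed.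

Lemma mcs_wellshaps a s :
  u (wellshaps a s) <-> (forall b, List.In b (a :: s) -> u (WellShap b)).
Proof.
rewrite /wellshaps; elim: s a => [|c s IHs] a /=.
  by split=> [wa b [<-|]|] //; apply; left.
rewrite mcs_And; split=> [[wa /IHs ws] b [<-|]|ws] //; first exact: ws.
by split; [apply: ws; left|apply/IHs => b bs; apply: ws; right].
Qed.

Lemma mcs_Box_consistent f : u (Box f) -> ~ u (Box (Neg f)).
Proof. by move=> /(mcs_MP (Ax1_D p0 f)); rewrite mcs_Neg. Qed.

Lemma mcs_Box_Bot : ~ u (Box (Bot p0)).
Proof.
move=> /mcs_Box_consistent; apply; apply: mcs_thm; apply: D_Nec; apply: D_ax.
by apply: Ax0 => v _ /=; case: (v _).
Qed.

(** If [f] failed, [Neg f] would be boxed as well, against axiom D. Hence worlds with the same boxed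
    formulas agree on such an [f]. *)
Lemma mcs_Box_decided f :
  LBA_axiom p0 (f ~~> Box f) -> LBA_axiom p0 (Neg f ~~> Box (Neg f)) ->
  u (Box f) <-> u f.
Proof.
move=> fB nfB; split=> [uBf|]; last exact: mcs_MP.
apply: contrapT => /(mcs_Neg mu)/(mcs_MP nfB).
exact: mcs_Box_consistent uBf.
Qed.

(** Every line of the derivation can be boxed: theorems by necessitation, modus ponens by K. *)
Lemma entails_unbox f : entails [set g | u (Box g)] f -> u (Box f).
Proof.
elim=> {f} [f df|f //|f g _ ufg _ uf].
  by apply: mcs_thm; exact: D_Nec.
by have /mcs_Imp := mcs_MP (Ax1_K p0 f g) ufg; apply.
Qed.

(** Axiom 4 carries [Box f] from [u] to [v], and axiom 5 carries [Neg (Box f)]. *)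
Lemma mcs_unbox_Box v : mcs v -> [set g | u (Box g)] `<=` v ->
  forall f, v (Box f) <-> u (Box f).
Proof.
move=> mv uv f; split=> [vf|/(mcs_MP (Ax1_4 p0 f))/uv //].
apply: contrapT => /(mcs_Neg mu)/(mcs_MP (Ax1_5 p0 f))/uv.
by rewrite mcs_Neg //.
Qed.

(** Otherwise axiom 14 would make the strict argument for falsum well-shaped, which axiom 17
    forbids. *)
Lemma mcs_arg_of_rule_consistent (R : rule At) : u (WellShap (arg_of_rule R)) ->
  ~ pcons (rcons (rprem R) (rconc R)) (Bot p0).
Proof.
move=> /(mcs_MP (Ax17 _ _ _ _)) + incons; rewrite mcs_Neg //; apply.
apply: (mcs_MP (Ax14 p0 _)).
  by rewrite conc_atoms_map_AtomArg /= map_rcons map_Conc_AtomArg.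
apply/mcs_wellshaps => b; rewrite conc_atoms_map_AtomArg -map_rcons.
(* Refolding the list as an image under [AtomArg] lets the induction treat its head like every other
   member. *)
rewrite -[_ :: _]/(map AtomArg (R.1.1 :: _)).
elim: (_ :: _) => //= f fs IHfs [<-|/IHfs //]; exact/mcs_axiom/Ax12.
Qed.

Lemma mcs_arg_of_rule_nonstrict (R : rule At) : u (WellShap (arg_of_rule R)) ->
  ~ pcons (rprem R) (rconc R).
Proof.
move=> /(mcs_MP (Ax18 _ _ _ _)) + strict; rewrite mcs_Neg //; apply.
apply: (mcs_MP (Ax14 p0 _)); first by rewrite /= map_Conc_AtomArg.
apply/mcs_wellshaps => b; rewrite -[_ :: _]/(map AtomArg (R.1.1 :: _)).
elim: (_ :: _) => //= f fs IHfs [<-|/IHfs //]; exact/mcs_axiom/Ax12.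
Qed.

End MaximalConsistent.

(** * The canonical model and the truth lemma *)

Section CanonicalModel.

Variables (w0 : set (fm At)) (mw0 : mcs w0).

Definition canonical_world : Type :=
  {u : set (fm At) | mcs u /\ forall f, u (Box f) <-> w0 (Box f)}.

Definition canonical_belief (u : canonical_world) : Prop :=
  [set g | w0 (Box g)] `<=` sval u.

(** The existence lemma: a Lindenbaum extension of the unboxed formulas is a world by
    [mcs_unbox_Box]. *)
Lemma canonical_belief_avoid f : ~ w0 (Box f) ->
  exists2 u : canonical_world, canonical_belief u & ~ sval u f.
Proof.
move=> nf; have [|u [mu w0u nuf]] := @lindenbaum [set g | w0 (Box g)] f.
  by move=> /(entails_unbox mw0).
by exists (exist _ u (conj mu (mcs_unbox_Box mw0 mu w0u))).
Qed.

Lemma canonical_world_nonempty : exists w : canonical_world, True.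
Proof. by exists (exist _ w0 (conj mw0 (fun=> iff_refl _))). Qed.

Lemma canonical_belief_nonempty : exists u : canonical_world, canonical_belief u.
Proof.
by have [u Bu _] := canonical_belief_avoid (mcs_Box_Bot mw0); exists u.
Qed.

Definition names (R : rule At) (p : At) : Prop :=
  w0 (Undercuts (AtomArg (Neg (Atom p))) (arg_of_rule R)).

(** The name is picked by choice; axiom 19 makes it unique. *)
Definition canonical_name (R : rule At) : option At :=
  if pselect (exists p, names R p) is left ex then Some (sval (cid ex))
  else None.

Lemma names_unique R p q : names R p -> names R q -> q = p.
Proof.
move=> Rp Rq; apply: contrapT => qp.
by have := mcs_MP mw0 (Ax19 p0 R qp) Rp; rewrite mcs_Neg.
Qed.

Lemma canonical_nameP R p : canonical_name R = Some p <-> names R p.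
Proof.
rewrite /canonical_name; case: pselect => [ex|nex]; last first.
  by split=> // Rp; case: nex; exists p.
case: cid => q /= Rq; split=> [[<-] //|Rp].
by rewrite (names_unique Rp Rq).
Qed.

Definition canonical : model p0 := @Model At p0
  canonical_world canonical_belief (fun a => w0 (Aware a))
  (fun R => w0 (WellShap (arg_of_rule R))) canonical_name
  (fun p (u : canonical_world) => sval u (Atom p))
  canonical_world_nonempty canonical_belief_nonempty
  (mcs_arg_of_rule_consistent mw0) (mcs_arg_of_rule_nonstrict mw0).

Lemma canonical_WS a : WS canonical a <-> w0 (WellShap a).
Proof.
elim/arg_nested_ind: a => [f|a s f IH|a s f IH].
- by split=> _; [exact: (mcs_axiom mw0 (Ax12 p0 f))|exact: WS_atom].
- rewrite WS_StrictArg; split=> [[ws sf]|ws].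
    by apply: mcs_MP (Ax14 p0 sf) _ => //; apply/mcs_wellshaps => // b sb;
       apply/IH => //; exact: ws.
  split=> [b sb|].
    have := mcs_MP mw0 (Ax13 p0 a s f) ws.
    by rewrite mcs_wellshaps // => /(_ b sb)/IH; apply.
  apply: contrapT => nsf.
  by have := mcs_axiom mw0 (Ax15 p0 nsf); rewrite mcs_Neg.
- rewrite WS_DefArg /= arg_of_rule_top.
  have /mcs_And-/(_ mw0)[/mcs_Imp-/(_ mw0) to] := mcs_axiom mw0 (Ax16 p0 a s f).
  move=> /mcs_Imp-/(_ mw0) from; split=> [[ws D]|/from].
    apply: to; apply/mcs_And => //; split=> //; apply/mcs_wellshaps => // b sb.
    by apply/IH => //; exact: ws.
  by move=> /mcs_And-/(_ mw0)[/mcs_wellshaps-/(_ mw0) ws D]; split=> // b sb;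
     apply/IH => //; exact: ws.
Qed.

(** Axioms 20 to 22 leave only a negated letter against a defeasible argument; axioms 23 and 24
    reduce that case to [names]. *)
Lemma canonical_undercuts a b :
  undercuts_in canonical a b <-> w0 (Undercuts a b).
Proof.
have absurd c : LBA_axiom p0 (Neg (Undercuts a c)) -> ~ w0 (Undercuts a c).
  by move=> /(mcs_axiom mw0); rewrite mcs_Neg.
have ConcIsE p : Conc a = Neg (Atom p) -> w0 (ConcIs a (Neg (Atom p))).
  by move=> ap; exact: (mcs_axiom mw0 (Ax8 p0 ap)).
case: b => [f|b s f|b s f].
- by split=> [[[? [? [? ]]]]|/absurd[]] //; exact: Ax20.
- by split=> [[[? [? [? ]]]]|/absurd[]] //; exact: Ax21.
rewrite undercuts_in_DefArg /=; split=> [[p]|ab].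
  move=> /canonical_nameP; rewrite /names arg_of_rule_top => Rp /ConcIsE ap.
  by apply: mcs_MP (Ax23 p0 a b s f p) _ => //; apply/mcs_And.
have [p ap] : exists p, Conc a = Neg (Atom p).
  apply: contrapT => nap; apply: absurd ab; apply: Ax22 => p ap.
  by apply: nap; exists p.
exists p => //; apply/canonical_nameP; rewrite /names arg_of_rule_top.
apply: mcs_MP (Ax24 p0 a b s f p) _ => //.
by apply/mcs_And => //; split=> //; exact: ConcIsE.
Qed.

Lemma canonical_truth (u : world canonical) f : sat u f <-> sval u f.
Proof.
have decided (v : canonical_world) g : LBA_axiom p0 (g ~~> Box g) ->
    LBA_axiom p0 (Neg g ~~> Box (Neg g)) -> sval v g <-> w0 g.
  case: v => v [mv vw0] gB ngB /=.
  by rewrite -(mcs_Box_decided mv gB ngB) -(mcs_Box_decided mw0 gB ngB).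
have settled (v : canonical_world) g (P : Prop) : (P -> LBA_axiom p0 g) ->
    (~ P -> LBA_axiom p0 (Neg g)) -> P <-> sval v g.
  case: v => v [mv _] Pg nPg /=; split=> [/Pg|vg]; first exact: mcs_axiom.
  by apply: contrapT => /nPg/(mcs_axiom mv); rewrite mcs_Neg.
(* The recursion stops at arguments: operators on them are handled by [decided] or [settled],
   whatever formulas occur inside. *)
elim: f u => /=.
- by [].
- by move=> f IHf u; rewrite IHf mcs_Neg //; case: (svalP u).
- by move=> f IHf g IHg u; rewrite IHf IHg mcs_And //; case: (svalP u).
(* Since [u] and [w0] share their boxed formulas, the case can be argued at [w0]. *)
- move=> f IHf u; have [_ ->] := svalP u; split=> [Bf|w0f v Bv].
    apply: contrapT => /canonical_belief_avoid[v Bv]; apply.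
    exact/IHf/Bf.
  exact/IHf/Bv.
- by move=> a u; rewrite decided //; [exact: Ax2|exact: Ax3].
- by move=> a f _ u; apply: settled; [exact: Ax8|exact: Ax9].
- by move=> a u; apply: settled; [exact: Ax10|exact: Ax11].
- move=> a b u; rewrite canonical_undercuts decided //; first exact: Ax6.
  exact: Ax7.
- by move=> a u; rewrite canonical_WS decided //; [exact: Ax4|exact: Ax5].
Qed.

End CanonicalModel.

Lemma completeness f : valid p0 f -> derivable p0 f.
Proof.
move=> vf; apply: contrapT => nf; have [|w0 [mw0 _ nw0f]] := @lindenbaum set0 f.
  move=> H; apply: nf; elim: H => {f vf} [//|//|f g _ + _]; exact: D_MP.
(* The set [w0] is itself a world of its canonical model, and validity applies there. *)
apply: nw0f; pose w : world (canonical mw0) :=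
  exist _ w0 (conj mw0 (fun=> iff_refl _)).
exact/(canonical_truth w)/vf.
Qed.

End Completeness.

Theorem theorem1 (At : countType) (p0 : At) (phi : fm At) :
  derivable p0 phi <-> valid p0 phi.
Proof. by split; [exact: soundness|exact: completeness]. Qed.
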